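(* Let $p$ be a prime and $G$ a finite group. Suppose that $\chi \in \mathrm{Irr}(G)$ is faithful, non-linear, and such that $\chi(x)$ is a root of unity for every $p$-singular element $x\in G$. Assume that $P=\mathbf{O}_p(G)>1$. Then either (1) $P$ is a Sylow $p$-subgroup of $G$, $P$ is elementary abelian, $\mathbf{C}_G(P)=P\times \mathbf{Z}(G)$, $G/\mathbf{C}_G(P)$ acts (by conjugation) transitively on $\mathrm{Irr}(P)-\{1_P\}$, and $\chi(1)=|P|-1$; or (2) $p=2$ and $G\cong S_4\times \mathbf{Z}(G)$, where $|\mathbf{Z}(G)|$ is odd.
   Context: $\mathrm{Irr}(G)$ denotes the set of irreducible complex characters of $G$; $1_P$ is the trivial character of $P$. An element is $p$-singular if its order is divisible by $p$. $\mathbf{O}_p(G)$ is the largest normal $p$-subgroup of $G$, $\mathbf{C}_G(P)$ the centralizer of $P$ in $G$, $\mathbf{Z}(G)$ the center of $G$, and $S_4$ the symmetric group on 4 letters. A character is faithful if its kernel is trivial, and non-linear if $\chi(1)>1$. *)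

(* Defs.v *)
From mathcomp Require Import all_boot all_order all_algebra all_fingroup all_solvable all_field all_character.
Set Implicit Arguments. Unset Strict Implicit. Unset Printing Implicit Defensive.
Import GRing.Theory Num.Theory.
Local Open Scope ring_scope.

Definition is_root_of_unity (z : algC) : Prop := exists n : nat, (0 < n)%N /\ n.-unity_root z.

Definition p_singular (gT : finGroupType) (p : nat) (x : gT) : bool := (p %| #[x]%g)%N.

(* Main.v *)
Require Import Defs.
From mathcomp Require Import all_boot all_order all_algebra all_fingroup all_solvable all_field all_character.
From mathcomp Require Import zify.
Set Implicit Arguments. Unset Strict Implicit. Unset Printing Implicit Defensive.
Import Order.TTheory GRing.Theory Num.Theory.
Local Open Scope group_scope.

(* Every nontrivial p-element x satisfies |chi x| = 1, so |Q| divides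
   chi(1)^2 - 1 for every p-subgroup Q, and p does not divide chi(1).  Hence
   chi_P = e (lambda_1 + ... + lambda_t) for a G-orbit of t linear characters,
   and computing the norm of chi_P gives e^2 t (q - t) = q - 1 with q = |P|,
   which forces e = 1 and t = q - 1: the orbit is all of Irr(P) - {1_P}.

   For a p'-element k of C_G(P), the group A = P<k> is abelian, so the norm of
   chi_A is at least chi(1); since the elements of A - <k> are p-singular this
   forces |chi k| = chi(1), that is, k is central.  Thus C_G(P) = P x Z(G).

   If a Sylow p-subgroup S is larger than P, then |S| divides q(q - 2), so p = 2
   and |S : P| = 2.  Comparing the norm q/2 of chi_S with the number of linear
   constituents of chi_S gives |P| <= 2 |S'|, while |S'|^2 <= |P|, so q = 4.
   Then |G : C_G(P)| = 6, the central extension G/P of S_3 by a group of odd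
   order splits, and the preimage L of the S_3 factor, which acts faithfully on
   its four Sylow 3-subgroups, is S_4, with G = L x Z(G). *)

(** * Recognising [S_4] and splitting off the center when [|P| = 4] *)

(** A nontrivial [x] in [P] has at most 3 conjugates and, once [x] is fixed, another [y] at most 2;
    an element fixing both fixes a subgroup of [P] of order at least 3, hence [P]. *)
Lemma index_cent_card4 (gT : finGroupType) (P G : {group gT}) :
  #|P| = 4 -> G \subset 'N(P) -> #|G : 'C_G(P)| <= 6.
Proof.
move=> oP nPG.
have [x /setD1P[ntx Px]] : exists x, x \in P^#.
  by apply/set0Pn; rewrite -card_gt0 cardsDS ?sub1G // oP cards1.
have oPx : #|P :\: [set 1; x]| = 2.
  by rewrite cardsDS ?subUset ?sub1set ?group1 // oP cards2 eq_sym ntx.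
have [y] : exists y, y \in P :\: [set 1; x] by apply/set0Pn; rewrite -card_gt0 oPx.
rewrite !inE negb_or -andbA => /and3P[nty neqyx Py].
pose H := 'C_G[x]%G.
have sHG : H \subset G := subsetIl _ _.
have iH : #|G : H| <= 3.
  rewrite index_cent1; have <- : #|P^#| = 3 by rewrite cardsDS ?sub1G // oP cards1.
  apply/subset_leq_card/subsetP => _ /imsetP[g Gg ->].
  by rewrite !inE conjg_eq1 ntx memJ_norm ?(subsetP nPG).
have iK : #|H : 'C_H[y]| <= 2.
  rewrite index_cent1 -oPx.
  apply/subset_leq_card/subsetP => _ /imsetP[h /setIP[Gh /cent1P cxh] ->].
  rewrite !inE conjg_eq1 negb_or nty memJ_norm ?(subsetP nPG) // Py andbT.
  have <- : x ^ h = x by apply/conjg_fixP/commgP.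
  by rewrite (inj_eq (conjg_inj h)).
have sKC : 'C_H[y] \subset 'C_G(P).
  apply/subsetP => g /setIP[/setIP[Gg cxg] cyg]; rewrite inE Gg /=.
  apply/centP => z Pz.
  suff /setIP[_ /cent1P] : z \in 'C_P[g] by [].
  suff -> : 'C_P[g] = P by [].
  apply/eqP; rewrite eqEcard subsetIl /= oP.
  have : #|'C_P[g]| %| 4 by rewrite -oP cardSg ?subsetIl.
  have : 3 <= #|'C_P[g]|.
    have <- : #|[set 1; x; y]| = 3.
      by rewrite setUC cardsU1 cards2 !inE negb_or nty neqyx eq_sym ntx.
    apply: subset_leq_card; rewrite !subUset !sub1set group1.
    by apply/andP; split; apply/setIP; rewrite cent1C.
  by case: #|_| => [|[|[|[|]]]].
apply: leq_trans (dvdn_leq _ (indexgS G sKC)) _; first exact: indexg_gt0.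
have <- := Lagrange_index sHG (subsetIl H 'C[y]).
exact: (leq_mul iH iK).
Qed.

(** The complement is generated by two conjugate involutions [a] and [b], whose product [u] is
    inverted by [a] and turns out to have order 3. *)
Lemma central_ext_S3_split (gT : finGroupType) (Y W : {group gT}) a :
    W \subset 'Z(Y) -> odd #|W| -> #|Y : W| = 6 ->
    a \in Y -> #[a] = 2 -> a \notin 'Z(Y) ->
  exists2 L : {group gT}, L \x W = Y & #|L| = 6.
Proof.
move=> sWZ oddW iW Ya oa notZa.
have [sWY cWY] := subsetIP sWZ.
have cW w y : w \in W -> y \in Y -> commute w y.
  by move=> Ww Yy; apply: (centsP cWY).
have sqW w : w \in W -> w ^+ 2 = 1 -> w = 1.
  move=> Ww w2; apply/eqP; rewrite -order_eq1 -dvdn1.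
  have <- : gcdn 2 #[w] = 1%N.
    apply/eqP; rewrite -/(coprime _ _) coprime2n.
    exact: dvdn_odd (order_dvdG Ww) oddW.
  by rewrite dvdn_gcd dvdnn order_dvdn w2 eqxx.
have [g Yg neq_ag] : exists2 g, g \in Y & a ^ g != a.
  apply/exists_inP; apply: contraR notZa; rewrite negb_exists_in => /forall_inP fix_a.
  rewrite inE Ya; apply/centP => y Yy; apply/commgP/conjg_fixP/eqP.
  by have := fix_a y Yy; rewrite negbK.
pose b := a ^ g; pose u := a * b.
have a2 : a ^+ 2 = 1 by rewrite -oa expg_order.
have aa : a * a = 1 := a2.
have aV : a^-1 = a by apply/eqP; rewrite eq_invg_mul aa.
have bV : b^-1 = b by rewrite /b -conjVg aV.
have Yb : b \in Y by rewrite groupJ.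
have Yu : u \in Y by rewrite groupM.
(* If [u] were in [W], then [b = a * u] with [u] central would give [u ^+ 2 = 1], so [u = 1] by
   oddness of [|W|]. *)
have notWu : u \notin W.
  apply/negP => Wu; have Db : b = a * u by rewrite /u mulgA aa mul1g.
  have /eqP : u ^+ 2 = 1.
    have : b ^+ 2 = 1 by rewrite /b -conjXg a2 conj1g.
    by rewrite Db expgMn ?a2 ?mul1g //; apply/commute_sym/cW.
  move/eqP/(sqW _ Wu) => u1; case/eqP: neq_ag.
  by rewrite -/b Db u1 mulg1.
have nWY : Y \subset 'N(W) by apply: subset_trans (cent_sub W); rewrite centsC.
have ua : u ^ a = u^-1 by rewrite conjgE /u invMg aV bV -(mulgA a b) (mulgA a a) aa mul1g.
(* The Sylow 3-subgroup [Q] of [Y / W] has index 2; modulo it the conjugates [a] and [b] coincide,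
   so the image of [u] lies in [Q]. *)
have Wu3 : u ^+ 3 \in W.
  have oQ : #|Y / W| = 6 by rewrite card_quotient.
  have [Q sylQ] := Sylow_exists 3 (Y / W).
  have oQ3 : #|Q| = 3 by rewrite (card_Hall sylQ) oQ p_part.
  have sQ := pHall_sub sylQ.
  have iQ : #|Y / W : Q| = 2 by rewrite -divgS // oQ oQ3.
  have nQ := normal_norm (index2_normal sQ iQ).
  have Nc y : y \in Y -> coset W y \in 'N(Q).
    by move=> Yy; apply: (subsetP nQ); apply: mem_quotient.
  have Qu : coset W u \in Q.
    apply: coset_idr; first exact: Nc.
    rewrite /u morphM ?(subsetP nWY) // morphM ?Nc //= /b.
    rewrite morphJ ?(subsetP nWY) // morphJ ?Nc //=.
    set c := coset Q _; set d := coset Q _.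
    have oX : #|Y / W / Q| = 2 by rewrite card_quotient.
    have abX : abelian (Y / W / Q) by rewrite cyclic_abelian // prime_cyclic ?oX.
    have Xc : c \in Y / W / Q by rewrite !mem_quotient.
    have Xd : d \in Y / W / Q by rewrite !mem_quotient.
    have -> : c ^ d = c by apply/conjg_fixP/commgP/(centsP abX).
    by rewrite -[c * c]/(c ^+ 2) -oX expg_cardG.
  apply: coset_idr; first by rewrite groupX ?(subsetP nWY).
  by rewrite morphX ?(subsetP nWY) // -oQ3 expg_cardG.
(* [a] both inverts and centralizes [u ^+ 3], which is therefore an element of [W] with trivial
   square. *)
have u3 : u ^+ 3 = 1.
  apply: sqW => //; apply/eqP; rewrite expgS expg1 -eq_invg_mul.
  by rewrite -expgVn -ua -conjXg; apply/eqP/esym/esym/conjg_fixP/commgP/cW.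
have ntu : u != 1 by apply: contra notWu => /eqP->; apply: group1.
have ou : #[u] = 3 by apply: nt_prime_order.
pose L := (<[u]> <*> <[a]>)%G.
have nua : <[a]> \subset 'N(<[u]>).
  by rewrite cycle_subG; apply/normP; rewrite -cycleJ ua cycleV.
have oL : #|L| = 6.
  rewrite /= norm_joinEr // TI_cardMg -?orderE ?ou ?oa //.
  by apply: coprime_TIg; rewrite -!orderE ou oa.
have tiLW : L :&: W = 1.
  have sylu : 3.-Sylow(L) <[u]>.
    by rewrite pHallE joing_subl oL p_part /= -orderE ou.
  have nu : <[u]> <| L by rewrite /normal joing_subl join_subG normG.
  have tiuW : <[u]> :&: W = 1 by rewrite prime_TIg -?orderE ?ou // cycle_subG.
  apply/trivgP; rewrite -tiuW subsetI subsetIr andbT.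
  rewrite (sub_normal_Hall sylu) ?subsetIl // /pgroup.
  have := cardSg (subsetIl L W); have := dvdn_odd (cardSg (subsetIr L W)) oddW.
  rewrite oL; case: #|_| => [|[|[|[|[|[|[|]]]]]]] //.
have sLY : L \subset Y by rewrite join_subG !cycle_subG Yu.
exists L => //; rewrite dprodE ?(subset_trans cWY (centS sLY)) //.
apply/eqP; rewrite eqEcard mul_subG //=.
by rewrite TI_cardMg // oL -(Lagrange sWY) iW mulnC.
Qed.

(** An injection of [L] into [S_n] is onto by order; the work lies in carrying the action on [X]
    over to ['I_n]. *)
Lemma faithful_action_Sym (aT : finGroupType) (T : finType)
    (to : {action aT &-> T}) (L : {group aT}) (X : {set T}) (n : nat) :
    [acts L, on X | to] -> [faithful L, on X | to] -> #|X| = n ->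
    #|L| = n`! ->
  L \isog [set: {perm 'I_n}].
Proof.
move=> actX ffX oX oL.
pose e (k : 'I_n) : T := enum_val (cast_ord (esym oX) k).
have eX k : e k \in X by apply: enum_valP.
have e_inj : injective e.
  by move=> k l /enum_val_inj/cast_ord_inj.
have e_onto x : x \in X -> exists k, e k = x.
  move=> Xx; exists (cast_ord oX (enum_rank_in Xx x)).
  by rewrite /e cast_ordK enum_rankK_in.
have toX x g : g \in L -> x \in X -> to x g \in X.
  by move=> Lg Xx; rewrite (acts_act actX).
(* [is_action] wants every [r g] injective, even for [g] outside [L], hence the identity there; for
   [g] in [L] the default of [odflt] is never reached. *)
pose r g (k : 'I_n) : 'I_n :=
  if g \in L then odflt k [pick l | e l == to (e k) g] else k.
have rE g k : g \in L -> e (r g k) = to (e k) g.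
  move=> Lg; rewrite /r Lg; case: pickP => [l /eqP // | none].
  have [l el] := e_onto _ (toX _ _ Lg (eX k)).
  by have := none l; rewrite el eqxx.
have rP : is_action L (fun k g => r g k).
  split=> [g k l | k g h Lg Lh].
    have [Lg | notLg] := boolP (g \in L); last by rewrite /r (negPf notLg).
    by move/(congr1 e); rewrite !rE // => /act_inj/e_inj.
  by apply: e_inj; rewrite !rE ?groupM // actM.
pose tor := Action rP.
have injr : 'injm (actperm tor).
  rewrite ker_actperm; apply/subsetP => g Cg; apply/set1P.
  have Lg : g \in L := astab_dom Cg.
  apply: (faithfulP ffX) => // _ /e_onto[k <-].
  by rewrite -rE //; congr e; apply: (astab_act Cg).
have isoL := sub_isog (subxx L) injr.
set I := (X in _ \isog X) in isoL.
suff <- : I = [set: {perm 'I_n}] by [].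
by apply/eqP; rewrite eqEcard subsetT cardsT card_Sn -(card_isog isoL) oL leqnn.
Qed.

(** [L] acts on its four Sylow 3-subgroups. The kernel meets [P] trivially, so it centralizes [P],
    so it lies in [P] and is trivial. *)
Lemma card24_isog_S4 (gT : finGroupType) (P L : {group gT}) :
    #|L| = 24 -> #|P| = 4 -> P <| L -> 'C_L(P) \subset P ->
  L \isog [set: {perm 'I_4}].
Proof.
move=> oL oP nsPL sCP; have [sPL nPL] := andP nsPL.
have [T sylT] := Sylow_exists 3 L; have [sTL pT _] := and3P sylT.
have oT : #|T| = 3 by rewrite (card_Hall sylT) oL p_part.
have tiPT : P :&: T = 1 by apply: coprime_TIg; rewrite oP oT.
have notCT : ~~ (T \subset 'C(P)).
  apply/negP => cPT; have : T \subset P :&: T.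
    by rewrite subsetI subxx andbT (subset_trans _ sCP) // subsetI sTL.
  by rewrite tiPT => /subset_leq_card; rewrite oT cards1.
(* The order of ['C_P(T)] divides 4 and is 1 modulo 3, so it is 1 or 4, and 4 would make [T]
   centralize [P]. *)
have CPT : 'C_P(T) = 1.
  have actT : [acts T, on P | 'J] by rewrite astabsJ (subset_trans sTL).
  have := pgroup_fix_mod pT actT; rewrite afixJ oP.
  have : #|'C_P(T)| %| 4 by rewrite -oP cardSg ?subsetIl.
  move=> dv E; apply/eqP; rewrite trivg_card1; apply: contraR notCT => ntC.
  have oC : #|'C_P(T)| = 4.
    by move: dv E ntC; case: #|_| => [|[|[|[|[|]]]]].
  rewrite centsC; apply/setIidPl/eqP.
  by rewrite eqEcard subsetIl oC oP.
(* A divisor of 8 that is 1 modulo 3 is 1 or 4; a unique Sylow 3-subgroup would be normal and so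
   commute with [P]. *)
have oSyl : #|'Syl_3(L)| = 4.
  have : #|'Syl_3(L)| %| 8.
    rewrite (card_Syl sylT) (_ : 8 = #|L : T|); last by rewrite -divgS // oL oT.
    by rewrite indexgS // subsetI sTL normG.
  have := card_Syl_mod L (isT : prime 3).
  have neq1 : #|'Syl_3(L)| != 1%N.
    rewrite (card_Syl sylT) indexg_eq1; apply: contra notCT => sLN.
    have nTL : L \subset 'N(T) by apply: subset_trans sLN (subsetIr _ _).
    apply/commG1P/trivgP; rewrite -tiPT setIC commg_subI // subsetI subxx /=.
      exact: subset_trans sTL nPL.
    exact: subset_trans sPL nTL.
  by move: neq1; case: #|_| => [|[|[|[|[|[|[|[|[|]]]]]]]]].
have actL : [acts L, on 'Syl_3(L) | 'JG] := atrans_acts (Syl_trans 3 L).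
apply: (faithful_action_Sym actL _ oSyl); last by rewrite oL.
set K := 'C_L('Syl_3(L) | 'JG).
have nsKL : K <| L.
  rewrite /normal subsetIl normsI ?normG //.
  exact: subset_trans actL (astab_norm _ _).
have sKN : K \subset 'N(T).
  apply/subsetP => x /setIP[_ fix_x].
  have sylT' : T \in 'Syl_3(L) by rewrite inE.
  by apply/normP; have /congr_group := astab_act fix_x sylT'.
have tiKP : K :&: P = 1.
  apply/trivgP; rewrite -CPT subsetI subsetIr /=.
  apply/commG1P/trivgP; rewrite -tiPT commg_subI // subsetI.
    by rewrite subsetIr subIset ?sKN.
  by rewrite subxx (subset_trans sTL).
rewrite /faithful -/K -tiKP subsetI subxx (subset_trans _ sCP) // subsetI subsetIl.
by apply/commG1P/trivgP; rewrite -tiKP commg_subI // subsetI subxx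
  ?(subset_trans _ nPL) ?(subset_trans _ (normal_norm nsKL)) ?subsetIl.
Qed.

(** In [G / P] the central subgroup ['Z(G) / P] equals [C / P] and has index 6, so it has a
    complement of order 6, whose preimage is the [S_4] factor [L]. *)
Lemma card4_pcore_isog_S4_center (gT : finGroupType) (P G S : {group gT}) :
    'O_2(G) = P -> #|P| = 4 -> P \x 'Z(G) = 'C_G(P) -> odd #|'Z(G)| ->
    2.-Sylow(G) S -> #|S : P| = 2 ->
  G \isog setX [set: {perm 'I_4}] 'Z(G).
Proof.
move=> defP oP defC oddZ sylS iSP.
have nsPG : P <| G by rewrite -defP pcore_normal.
have [sPG nPG] := andP nsPG; pose C := 'C_G(P)%G.
have {}defC : P \x 'Z(G) = C by [].
have [_ defPZ cPZ tiPZ] := dprodP defC.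
have sCG : C \subset G := subsetIl _ _.
have [sSG pS p'iS] := and3P sylS.
have sPS : P \subset S by rewrite -defP pcore_sub_Hall.
have nPS := subset_trans sSG nPG.
have nsPS : P <| S by rewrite /normal sPS.
have sPC : P \subset C by rewrite -defPZ mulG_subl.
have defW : C / P = 'Z(G) / P by rewrite -defPZ quotientMidl.
have iWC : #|G / P : 'Z(G) / P| = #|G : C|.
  by rewrite -defW; apply: index_quotient_eq; rewrite // subIset ?sPC ?orbT.
have sWZ : 'Z(G) / P \subset 'Z(G / P) by apply: morphim_center.
have oddW : odd #|'Z(G) / P| by apply: dvdn_odd (dvdn_quotient _ _) oddZ.
have oSP : #|S / P| = 2 by rewrite card_quotient.
have [a Sa oa] : exists2 a, a \in S / P & #[a] = 2.
  by have [//||a Sa oa] := @Cauchy _ 2 (S / P); [rewrite oSP | exists a].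
have Ya : a \in G / P by apply: subsetP Sa; apply: quotientS.
(* Otherwise [S / P = <[a]>] is normal in [G / P], and [S] is a normal 2-subgroup of [G], hence
   inside [P]. *)
have notZa : a \notin 'Z(G / P).
  apply/negP => Za; suff : #|S : P| = 1%N by rewrite iSP.
  apply/eqP; rewrite indexg_eq1 -defP pcore_max //.
  suff : S / P <| G / P by rewrite -cosetpre_normal !quotientGK.
  have <- : <[a]> = S / P.
    by apply/eqP; rewrite eqEcard cycle_subG Sa -orderE oa oSP.
  by rewrite sub_center_normal ?cycle_subG.
(* By [E], [|G : C|] is twice an odd number, so 2 or 6. Index 2 would give [G / P] a cyclic quotient
   by a central subgroup, making it abelian against [notZa]. *)
have iC : #|G : C| = 6.
  have le6 : #|G : C| <= 6 := index_cent_card4 oP nPG.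
  have oC : #|C| = (4 * #|'Z(G)|)%N by rewrite -(dprod_card defC) oP.
  have E : (#|G : C| * #|'Z(G)| = 2 * #|G : S|)%N.
    apply/eqP; rewrite -(eqn_pmul2l (isT : 0 < 4)) mulnCA -oC mulnC Lagrange //.
    have oS : #|S| = (4 * 2)%N by rewrite -(Lagrange sPS) oP iSP.
    by rewrite mulnA -oS Lagrange.
  have oddGS : odd #|G : S| by rewrite odd_2'nat.
  have neq2 : #|G : C| != 2.
    apply: contra notZa => /eqP iC2; suff /center_idP-> : abelian (G / P) by [].
    apply: (cyclic_factor_abelian sWZ).
    rewrite prime_cyclic // card_quotient ?iWC ?iC2 //.
    by rewrite normal_norm // sub_center_normal.
  have : odd (#|G : C|./2).
    have evC : ~~ odd #|G : C|.
      by have := congr1 odd E; rewrite !oddM oddZ andbT => ->.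
    have := E; rewrite -[in LHS](odd_double_half #|G : C|) (negPf evC) add0n.
    rewrite -mul2n -mulnA => /eqP; rewrite eqn_pmul2l // => /eqP/(congr1 odd).
    by rewrite oddM oddGS => /andP[].
  have : ~~ odd #|G : C|.
    by have := congr1 odd E; rewrite !oddM oddZ andbT => ->.
  by move: le6 neq2 (indexg_gt0 G C); case: #|_ : _| => [|[|[|[|[|[|[|]]]]]]].
have iW : #|G / P : 'Z(G) / P| = 6.
  by rewrite iWC.
have [Lb defY oLb] := central_ext_S3_split sWZ oddW iW Ya oa notZa.
have [_ defLW _ tiLW] := dprodP defY.
have sLbY : Lb \subset G / P by rewrite -defLW mulG_subl.
have [L defLb sPL sLG] := inv_quotientS nsPG sLbY.
have nPL := subset_trans sLG nPG.
have nsPL : P <| L by rewrite /normal sPL.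
have oL : #|L| = 24.
  by rewrite -(Lagrange sPL) oP -card_quotient // -defLb oLb.
have sLCP : L :&: C \subset P.
  have tiLC : L / P :&: C / P = 1 by rewrite -defLb defW.
  rewrite -quotient_sub1 ?(subset_trans (subsetIl _ _)) // -tiLC.
  by rewrite subsetI !quotientS ?subsetIl ?subsetIr.
have sZC : 'Z(G) \subset C by rewrite -defPZ mulG_subr.
have tiLZ : L :&: 'Z(G) = 1.
  apply/trivgP; rewrite -tiPZ subsetI subsetIr andbT.
  by rewrite (subset_trans _ sLCP) // setIS.
have defG : L \x 'Z(G) = G.
  rewrite dprodE // ?(subset_trans (subsetIr _ _)) ?centS //.
  apply/eqP; rewrite eqEcard mul_subG ?center_sub //=.
  by rewrite TI_cardMg // oL -(Lagrange sCG) iC -(dprod_card defC) oP mulnAC.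
have isoL : L \isog [set: {perm 'I_4}].
  apply: card24_isog_S4 oL oP nsPL _.
  by rewrite (subset_trans _ sLCP) // subsetI subsetIl setSI.
apply: isog_dprod defG (setX_dprod [set: {perm 'I_4}]%G 'Z(G)%G) _ _.
  exact: isog_trans isoL (isog_setX1 _ _).
exact: isog_set1X.
Qed.

Local Open Scope ring_scope.

(** * Degree and norm estimates, and groups with an abelian subgroup of index 2 *)

Lemma norm_root_of_unity (z : algC) : is_root_of_unity z -> `|z| = 1.
Proof.
case=> n [n_gt0 /unity_rootP zn1].
by apply/eqP; rewrite -(@pexpr_eq1 _ _ n) ?normr_ge0 // -normrX zn1 normr1.
Qed.

Lemma pgroup_p_singular (gT : finGroupType) (p : nat) (Q : {group gT}) x :
  p.-group Q -> x \in Q -> x != 1%g -> p_singular p x.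
Proof.
move=> pQ Qx ntx; have px : p.-group <[x]> by exact: mem_p_elt pQ Qx.
have [|_ ? _] := pgroup_pdiv px; first by rewrite cycle_eq1.
by [].
Qed.

(** By Frobenius reciprocity, ['chi_i] is a constituent of a linear character of [A] induced to
    [S]. *)
Lemma irr1_le_index_abelian (gT : finGroupType) (A S : {group gT})
    (i : Iirr S) :
  abelian A -> A \subset S -> 'chi_i 1%g <= #|S : A|%:R.
Proof.
move=> abA sAS.
have [j Aj] := constt_cfRes_irr A i.
have <- : 'Ind[S] 'chi_j 1%g = #|S : A|%:R.
  by rewrite cfInd1 // (lin_char1 (char_abelianP _ abA j)) mulr1.
by rewrite char1_ge_constt ?constt_Ind_Res // cfInd_char ?irr_char.
Qed.

Lemma abelian_char1_le_cfnorm (gT : finGroupType) (A : {group gT})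
    (phi : 'CF(A)) :
  abelian A -> phi \is a character -> phi 1%g <= '[phi].
Proof.
move=> abA Nphi; rewrite {1}[phi]cfun_sum_cfdot sum_cfunE cfdot_sum_irr.
apply: ler_sum => i _; rewrite cfunE (lin_char1 (char_abelianP _ abA i)) mulr1.
have /natrP[n ->] := Cnat_cfdot_char_irr i Nphi.
by rewrite conjC_nat -natrM ler_nat; nia.
Qed.

(** The hypothesis is [e^2 t (q - t) = q - 1] freed of subtraction. With [q = t + k + 1] it yields
    [t (k + 1) <= t + k], so [k = 0] or [t = 1]; the latter forces [e = 1], against [1 < e * t]. *)
Lemma orbit_count_arith (e t q : nat) :
  (e * e * t * q + 1 = e * e * t * t + q -> 1 < q -> 1 < e * t ->
   e = 1 /\ t = q.-1)%N.
Proof.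
move=> E q_gt1 et_gt1.
have lt_tq : (t < q)%N by rewrite ltnNge; apply/negP => le_qt; nia.
have [k def_q] : exists k, q = (t + k.+1)%N by exists (q - t.+1)%N; lia.
subst q; have {}E : (e * e * (t * k.+1) = t + k)%N by nia.
have [e0 | ee_gt0] : e = 0%N \/ (0 < e * e)%N by nia.
  by move: et_gt1; rewrite e0.
have le1 : (t * k.+1 <= t + k)%N by nia.
have [k0 | t1] : k = 0%N \/ t = 1%N by nia.
  by subst k; split; [nia | lia].
by subst t; nia.
Qed.

(** Compare constituents, each of multiplicity [m]: a linear one has degree 1 and is trivial on S';
    any other has degree at most 2 and no trivial part on S'. Each adds at most [2 m <= 2 m^2]. *)
Lemma cfnorm_ge_index2_abelian (gT : finGroupType) (A S : {group gT})
    (phi : 'CF(S)) :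
    abelian A -> A \subset S -> #|S : A| = 2%N -> phi \is a character ->
  phi 1%g + '['Res[S^`(1)] phi, 1] <= '[phi] *+ 2.
Proof.
move=> abA sAS iA Nphi; rewrite cfdot_sum_irr -sumrMnl.
rewrite {1 2}[phi]cfun_sum_cfdot sum_cfunE linear_sum cfdot_suml -big_split /=.
apply: ler_sum => k _; rewrite cfunE linearZ cfdotZl -mulrDr /=.
have /natrP[m ->] := Cnat_cfdot_char_irr k Nphi.
apply: (@le_trans _ _ (m%:R *+ 2)); last first.
  by rewrite conjC_nat -natrM lerMn2r /= ler_nat; nia.
rewrite -[leRHS]mulr_natr; apply: ler_wpM2l; first exact: ler0n.
have [D1 | D1] := boolP (0 \in irr_constt ('Res[S^`(1)] 'chi_k)).
  have kerD := constt0_Res_cfker (der_normal 1 S) D1.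
  have lin_k : 'chi_k \is a linear_char by rewrite lin_irr_der1.
  by rewrite cfRes_sub_ker // (lin_char1 lin_k) scale1r cfnorm1.
move: D1; rewrite irr_consttE negbK irr0 => /eqP->.
by rewrite addr0 -iA irr1_le_index_abelian.
Qed.

(** For [a] in [S] outside [P], commutation with [a] is an endomorphism [f] of [P] with trivial
    square, so its image lies in its kernel; S' lies in the image. *)
Lemma index2_abelem_der1 (gT : finGroupType) (P S : {group gT}) :
  2.-abelem P -> P \subset S -> #|S : P| = 2%N -> (#|S^`(1)%g| ^ 2 <= #|P|)%N.
Proof.
move=> abelP sPS iP; have abP := abelem_abelian abelP.
have nsPS := index2_normal sPS iP; have nPS := normal_norm nsPS.
have /properP[_ [a Sa notPa]] : P \proper S.
  by rewrite properEneq sPS andbT; apply: contra_eqN iP => /eqP->; rewrite indexgg.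
have nPa := subsetP nPS a Sa.
have sqP x : x \in P -> (x * x = 1)%g.
  by move=> Px; have [_ /(_ x Px)] := abelemP (isT : prime 2) abelP.
have Pa2 : (a ^+ 2)%g \in P.
  apply: coset_idr; first by rewrite groupX.
  rewrite morphX //; apply/eqP; rewrite -order_dvdn.
  by rewrite (dvdn_trans (order_dvdG (mem_quotient P Sa))) // card_quotient ?iP.
have cP x y : x \in P -> y \in P -> (x * y = y * x)%g.
  by move=> Px Py; apply: (centsP abP).
pose f x := (x * x ^ a)%g.
have fM : {in P &, {morph f : x y / (x * y)%g}}.
  move=> x y Px Py; rewrite /f conjMg -(mulgA x) (mulgA y) (cP y) ?memJ_norm //.
  by rewrite -(mulgA (x ^ a)%g) (mulgA x).
pose fm := Morphism fM.
have fP x : x \in P -> f x \in P by move=> Px; rewrite groupM ?memJ_norm.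
(* [a ^+ 2] lies in the abelian group [P], so [a] swaps [x] and [x ^ a]. Hence [f (f x)] is the
   square of [f x], that is, 1. *)
have faE x : x \in P -> (f x ^ a = f x)%g.
  move=> Px; rewrite /f conjMg -conjgM -[(a * a)%g]/(a ^+ 2)%g.
  have -> : (x ^ (a ^+ 2) = x)%g by apply/conjg_fixP/commgP/(centsP abP).
  by apply: cP; rewrite ?memJ_norm.
pose R := (fm @* P)%G.
have RP x : x \in R -> exists2 y, y \in P & x = f y.
  by case/morphimP=> y _ Py ->; exists y.
have cRS : S \subset 'C(R).
  apply/centsP => s Ss x /RP[y Py ->].
  have [Ps | notPs] := boolP (s \in P); first by apply: (centsP abP); rewrite ?fP.
  have : s \in P :* a by rewrite (rcoset_index2 sPS iP) !inE ?notPa ?notPs.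
  case/rcosetP=> z Pz ->; apply/commute_sym/commuteM.
    by apply: (centsP abP); rewrite ?fP.
  by apply/commgP/conjg_fixP; rewrite faE.
have nRS : S \subset 'N(R) by apply: subset_trans cRS (cent_sub _).
have sRker : R \subset 'ker fm.
  apply/subsetP => x /RP[y Py ->]; rewrite !inE fP //=.
  by rewrite /f -/(f y) faE // sqP ?fP.
have oP : (#|R| * #|'ker fm|)%N = #|P|.
  by rewrite card_morphim setIid -(Lagrange (subsetIl P _ : 'ker fm \subset P)) mulnC.
have sDR : S^`(1)%g \subset R.
  rewrite der1_min //.
  have defS : P <*> <[a]> = S.
    apply/eqP; rewrite eqEsubset join_subG sPS cycle_subG Sa /=.
    apply/subsetP => s Ss; have [Ps | notPs] := boolP (s \in P).
      by rewrite mem_gen // inE Ps.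
    have : s \in P :* a by rewrite (rcoset_index2 sPS iP) !inE ?notPa ?notPs.
    case/rcosetP=> z Pz ->; rewrite groupM //.
      by rewrite mem_gen // inE Pz.
    by rewrite mem_gen // inE cycle_id orbT.
  have [nRP nRa] := (subset_trans sPS nRS, subsetP nRS a Sa).
  rewrite -defS quotientY ?cycle_subG // abelianY quotient_abelian //=.
  rewrite quotient_cycle // cycle_abelian /= centsC cent_cycle.
  apply/subsetP => _ /morphimP[x Nx Px ->]; apply/cent1P/commgP.
  rewrite -morphR //= coset_id //.
  have <- : f x = [~ x, a].
    rewrite /f commgEl; congr (_ * _)%g.
    by apply/esym/eqP; rewrite eq_invg_mul sqP.
  by rewrite (mem_morphim fm).
rewrite -oP expnS expn1 leq_mul ?subset_leq_card //.
exact: subset_trans sDR sRker.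
Qed.

(** * Restriction of [chi] to p-subgroups and to normal p-subgroups *)

Section UnimodularOnPSingular.

Variables (gT : finGroupType) (p : nat) (G : {group gT}) (i : Iirr G).
Local Notation chi := 'chi_i.
Hypotheses (pr_p : prime p) (chi_ff : cfaithful chi) (chi1_gt1 : 1 < chi 1%g).
Hypothesis norm_chi : forall x, x \in G -> p_singular p x -> `|chi x| = 1.

Lemma cfnorm_Res_pgroup (Q : {group gT}) :
  p.-group Q -> Q \subset G ->
  #|Q|%:R * '['Res[Q] chi] = chi 1%g ^+ 2 + #|Q|.-1%:R.
Proof.
move=> pQ sQG; rewrite (cfnormE (cfun_onG _)) mulVKf ?neq0CG //.
rewrite (big_setD1 1%g) //= cfRes1 ger0_norm ?char1_ge0 ?irr_char //.
congr (_ + _); rewrite (eq_bigr (fun=> 1)) => [|x /setD1P[ntx Qx]].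
  by rewrite sumr_const (cardsD1 1%g Q) group1.
by rewrite cfResE // norm_chi ?expr1n ?(subsetP sQG) ?(pgroup_p_singular pQ).
Qed.

Section NormalSubgroup.

Variable P : {group gT}.
Hypotheses (pP : p.-group P) (nsPG : P <| G) (ntP : P :!=: 1%g).

(** By Clifford, [chi 1] is [e * (t * d)] for multiplicity [e], orbit size [t] and constituent
    degree [d]; once [d = 1], the norm formula feeds [orbit_count_arith]. *)
Lemma Res_normal_pgroup :
  chi 1%g = #|P|%:R - 1
  /\ exists j : Iirr P, [/\ j != 0, '['Res[P] chi, 'chi_j] = 1
       & {subset irr P <= 1 :: ('chi_j ^: G)%CF}].
Proof.
have sPG := normal_sub nsPG.
have [j chi_j] := constt_cfRes_irr P i.
have NchiP : 'Res[P] chi \is a character by rewrite cfRes_char ?irr_char.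
have /natrP[e De] := Cnat_cfdot_char_irr j NchiP.
pose X := ('chi_j ^: G)%CF; pose t := size X.
have irrX xi : xi \in X -> xi \in irr P.
  by case/cfclassP=> y _ ->; apply: cfConjg_irr; apply: mem_irr.
have X1 xi : xi \in X -> xi 1%g = 'chi_j 1%g.
  by case/cfclassP=> y _ ->; rewrite cfConjg1.
have /natrP[n Dn] := Cnat_irr1 i.
have /natrP[d Dd] := Cnat_irr1 j.
have DchiP := Clifford_Res_sum_cfclass nsPG chi_j; rewrite De in DchiP.
have Dnetd : n = (e * (t * d))%N.
  apply/eqP; rewrite -eqC_nat -Dn -(cfRes1 P) DchiP cfunE sum_cfunE.
  rewrite big_seq (eq_bigr (fun=> d%:R)) => [|xi /X1]; last by rewrite Dd.
  by rewrite -big_seq big_const_seq count_predT iter_addr_0 !natrM [t%:R * _]mulr_natl.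
have EP := cfnorm_Res_pgroup pP sPG.
have normP : '['Res[P] chi] = (e * e * t)%:R.
  rewrite DchiP cfdotZl cfdotZr conjC_nat cfdot_suml.
  rewrite mulrA 2!natrM; congr (_ * _).
  rewrite big_seq (eq_bigr (fun=> 1)) => [|xi Xxi].
    by rewrite -big_seq big_const_seq count_predT iter_addr_0.
  rewrite cfdot_sumr (bigD1_seq xi) ?cfclass_uniq //= irrWnorm ?irrX //.
  rewrite big_seq_cond big1 ?addr0 // => xi' /andP[Xxi' nxi].
  have /irrP[k Dk] := irrX _ Xxi; have /irrP[k' Dk'] := irrX _ Xxi'.
  rewrite Dk Dk' cfdot_irr; case: eqP => // Ek.
  by rewrite Dk Dk' Ek eqxx in nxi.
have q_gt1 : (1 < #|P|)%N by rewrite cardG_gt1.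
have n_gt1 : (1 < n)%N by rewrite -ltC_nat -Dn.
move: EP; rewrite normP Dn -natrX -natrM -natrD => /eqP.
rewrite eqC_nat => /eqP EP.
(* [d] is a power of [p]; if [p] divided it, [p] would divide [n], and then [|P| - 1] by [EP]. *)
have d1 : d = 1%N.
  have [_ p_q [m Dq]] := pgroup_pdiv pP ntP.
  have := dvd_irr1_cardG j; rewrite Dd dvdC_nat Dq => /dvdn_pfactor[]// [|k] _ //.
  move=> Dd'; have p_n : (p %| n)%N.
    by rewrite Dnetd Dd' expnS; apply/dvdn_mull/dvdn_mull/dvdn_mulr.
  have : (p %| (n ^ 2 + #|P|.-1))%N by rewrite -EP dvdn_mulr.
  rewrite dvdn_addr ?dvdn_exp // => p_q1.
  have : (p %| #|P|.-1.+1)%N by rewrite prednK.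
  by rewrite -addn1 dvdn_addr // dvdn1; case: eqP pr_p => // ->.
rewrite d1 !muln1 in Dnetd Dd.
have [e1 t_q] : e = 1%N /\ t = #|P|.-1.
  apply: orbit_count_arith; rewrite -?Dnetd //.
  by move: EP q_gt1; rewrite Dnetd -mulnn; move: #|P| => q; clear; nia.
rewrite e1 mul1n t_q in Dnetd.
split; first by rewrite Dnetd -subn1 natrB // ltnW.
have nz_j : j != 0.
  apply: contraTneq (n_gt1) => j0; rewrite Dnetd -t_q /t /X j0 irr0.
  by rewrite cfclass1.
exists j; split=> [||psi irr_psi] //; first by rewrite De e1.
(* A further [psi] would make [t + 2 = |P| + 1] irreducible characters, more than [P] has conjugacy
   classes. *)
apply: contraT => notXpsi.
have uX : uniq [:: psi, 1 & X].
  rewrite /= notXpsi cfclass_uniq // andbT.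
  apply: contra nz_j => /cfclassP[y Gy /esym/eqP].
  by rewrite cfConjg_eq1 irr_eq1.
have /(uniq_leq_size uX) : {subset [:: psi, 1 & X] <= irr P}.
  move=> xi; rewrite !inE => /or3P[/eqP-> // | /eqP-> | /irrX//].
  by rewrite -irr0 mem_irr.
rewrite size_tuple NirrE /= -/t t_q prednK ?(ltnW q_gt1) //.
by rewrite ltnNge leq_imset_card.
Qed.

Lemma Res_normal_pgroup1 : chi 1%g = #|P|%:R - 1.
Proof. by have [] := Res_normal_pgroup. Qed.

Lemma irr_normal_pgroup_transitive (k l : Iirr P) :
  'chi_k != 1 -> 'chi_l != 1 -> exists2 g, g \in G & ('chi_k ^ g)%CF = 'chi_l.
Proof.
move=> ntk ntl; have [_ [j [_ _ Xj]]] := Res_normal_pgroup.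
have := Xj _ (mem_irr k); rewrite inE (negPf ntk) => /cfclassP[y Gy ->].
have := Xj _ (mem_irr l); rewrite inE (negPf ntl) => /cfclassP[z Gz ->].
exists (y^-1 * z)%g; first by rewrite groupM ?groupV.
by rewrite (cfConjgM _ nsPG) ?groupV // cfConjgK.
Qed.

(** A nontrivial character lifted from [P / 'Phi(P)] has ['Phi(P)] in its kernel; by transitivity so
    do all characters, and their kernels intersect trivially. *)
Lemma normal_pgroup_abelem : p.-abelem P.
Proof.
rewrite -(trivg_Phi pP) -subG1 -(TI_cfker_irr P).
have nsPhi := Phi_normal P.
have [k ntk] : exists k : Iirr (P / 'Phi(P)), k != 0.
  have: (1 < #|Iirr (P / 'Phi(P))|)%N.
    rewrite card_ord NirrE classes_gt1 -subG1 quotient_sub1 ?normal_norm //.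
    by rewrite proper_subn // Phi_proper.
  rewrite (cardD1 0) ltnS => /card_gt0P[k]; rewrite !inE andbT => ntk.
  by exists k.
pose l := mod_Iirr k.
have ntl : 'chi_l != 1 by rewrite irr_eq1 mod_Iirr_eq0.
have kerl : 'Phi(P) \subset cfker 'chi_l by rewrite mod_IirrE ?cfker_mod.
apply/bigcapsP => m _; have [-> | ntm] := eqVneq 'chi_m 1.
  by rewrite cfker_cfun1 Phi_sub.
have [g Gg <-] := irr_normal_pgroup_transitive ntl ntm.
have nPg : g \in 'N(P) by apply: subsetP Gg; apply: normal_norm.
rewrite cfker_conjg // -(normsP (char_norm_trans (Phi_char P) (normal_norm nsPG)) g Gg).
by rewrite conjSg.
Qed.

Let abP : abelian P := abelem_abelian normal_pgroup_abelem.

(** Transitivity gives every nontrivial character multiplicity 1; the trivial one is absent, since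
    otherwise [P] would lie in the kernel of [chi]. *)
Lemma Res_normal_pgroupE : 'Res[P] chi = cfReg P - 1.
Proof.
rewrite cfReg_sum [LHS]cfun_sum_cfdot (bigD1 0) //= [in RHS](bigD1 0) //=.
rewrite irr0 cfun11 scale1r [in RHS]addrAC subrr add0r.
have -> : '['Res[P] chi, 1] = 0.
  apply: contraTeq chi1_gt1; rewrite -irr0 -irr_consttE => /(constt0_Res_cfker nsPG).
  move/subset_trans/(_ chi_ff); by rewrite subG1 (negPf ntP).
rewrite scale0r add0r; apply: eq_bigr => k ntk.
rewrite (lin_char1 (char_abelianP _ abP k)).
have [_ [j [ntj <- _]]] := Res_normal_pgroup.
rewrite -!irr_eq1 in ntj ntk; have [g Gg <-] := irr_normal_pgroup_transitive ntj ntk.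
by rewrite cfdot_Res_conjg.
Qed.

Lemma p'elt_cent_normal_pgroup k : k \in 'C_G(P) -> p^'.-elt k -> k \in 'Z(G).
Proof.
case/setIP=> Gk cPk p'k; have sPG := normal_sub nsPG.
have cPK : <[k]> \subset 'C(P) by rewrite cycle_subG.
have coPK : coprime #|P| #|<[k]>| by apply: pnat_coprime pP p'k.
have tiPK := coprime_TIg coPK.
have defA := dprodEY cPK tiPK; set A := (P <*> <[k]>)%G in defA.
have abA : abelian A.
  by rewrite abelianY; apply/and3P; split; rewrite ?cycle_abelian // centsC.
have sAG : A \subset G by rewrite join_subG sPG cycle_subG.
have oA : (#|P| * #[k])%N = #|A| := dprod_card defA.
have sKA : <[k]> \subset A by rewrite joing_subr.
rewrite -(cfcenter_fful_irr chi_ff) irr_cfcenterE //.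
have Nchi := irr_char i.
have n1 := Res_normal_pgroup1.
have Dn : chi 1%g = #|P|.-1%:R by rewrite n1 -subn1 natrB ?cardG_gt0.
(* Put [q = |P|] and [c = #[k]]. If [|chi k| < chi 1], the sum over [<[k]>] is below [c (q - 1)^2],
   and the norm bound gives [c q (q - 1) < c (q - 1)^2 + c (q - 1)], whose two sides are equal. *)
apply: contraT => lt_k.
have := abelian_char1_le_cfnorm abA (cfRes_char A Nchi).
rewrite cfRes1 (cfnormE (cfun_onG _)) -(ler_pM2l (gt0CG A)) mulVKf ?neq0CG //.
rewrite (big_setID <[k]>%g) /= (setIidPr sKA).
have -> : \sum_(x in A :\: <[k]>) `|'Res[A] chi x| ^+ 2 = (#|A| - #[k])%:R.
  rewrite (eq_bigr (fun=> 1)) => [|a /setDP[Aa]].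
    by rewrite sumr_const cardsD (setIidPr sKA).
  have [x [y [Px Ky Da _]]] := mem_dprod defA Aa => notKa.
  rewrite cfResE // norm_chi ?expr1n ?(subsetP sAG) // Da.
  have ntx : x != 1%g by apply: contra notKa => /eqP x1; rewrite Da x1 mul1g.
  rewrite /p_singular orderM; last 1 first.
  - apply: pnat_coprime (mem_p_elt pP Px) _.
    by apply: (pnat_dvd (order_dvdG Ky)).
  - by rewrite dvdn_mulr //; apply: pgroup_p_singular pP Px ntx.
  by apply/esym/(centP (subsetP cPK y Ky)).
rewrite Dn => le1.
have: \sum_(x in <[k]>) `|'Res[A] chi x| ^+ 2 < (#[k] * #|P|.-1 ^ 2)%:R.
  have sumE : \sum_(x in <[k]>) ((#|P|.-1)%:R ^+ 2 : algC) = (#[k] * #|P|.-1 ^ 2)%:R.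
    by rewrite sumr_const natrM natrX mulr_natl.
  rewrite -sumE (bigD1 k) ?cycle_id //= [ltRHS](bigD1 k) ?cycle_id //=.
  have le_chi x : x \in <[k]> -> `|'Res[A] chi x| <= (#|P|.-1)%:R.
    by move=> Kx; rewrite cfResE ?(subsetP sKA) // -Dn char1_ge_norm.
  apply: ltr_leD.
    rewrite ltr_pXn2r ?nnegrE ?normr_ge0 ?ler0n // lt_neqAle le_chi ?cycle_id //.
    by rewrite cfResE ?(subsetP sKA) ?cycle_id // -Dn lt_k.
  apply: ler_sum => x /andP[Kx _].
  by rewrite lerXn2r ?nnegrE ?normr_ge0 ?ler0n ?le_chi.
rewrite -(ltrD2r (#|A| - #[k])%:R) => /(le_lt_trans le1).
rewrite -natrM -natrD ltC_nat -oA.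
have := cardG_gt0 P; case: #|P| => // q _ /=.
rewrite mulSn addKn ltnNge mulnDl -mulnn mulnA [(q * _)%N]mulnC addnC.
by rewrite leqnn.
Qed.

End NormalSubgroup.

(** A central element of order [p] would be p-singular, with value of modulus 1, while central
    elements have modulus [chi 1 > 1]. *)
Lemma p'group_center : p^'.-group 'Z(G).
Proof.
apply/pgroupP => r pr_r /Cauchy[]// z Zz oz.
apply: contraL (chi1_gt1) => /eqP rp.
have Gz : z \in G by apply: subsetP Zz; apply: center_sub.
have := norm_chi Gz _; rewrite /p_singular oz rp dvdnn => /(_ isT) <-.
move: Zz; rewrite /= -(cfcenter_fful_irr chi_ff) irr_cfcenterE // => /eqP->.
by rewrite ltxx.
Qed.

End UnimodularOnPSingular.

(** * The centralizer of [O_p(G)], and the case where [O_p(G)] is not Sylow *)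

Section Exceptional.
Variables (gT : finGroupType) (p : nat) (G : {group gT}) (i : Iirr G).
Local Notation chi := 'chi_i.
Hypotheses (pr_p : prime p) (chi_ff : cfaithful chi) (chi1_gt1 : 1 < chi 1%g).
Hypothesis norm_chi : forall x, x \in G -> p_singular p x -> `|chi x| = 1.
Local Notation P := 'O_p(G)%G.
Hypothesis ntP : P :!=: 1%g.

Let pP : p.-group P := pcore_pgroup p G.
Let nsPG : P <| G := pcore_normal p G.
Let sPG : P \subset G := normal_sub nsPG.
Let abelP : p.-abelem P.
Proof. exact: (normal_pgroup_abelem pr_p chi1_gt1 norm_chi pP nsPG ntP). Qed.
Let abP : abelian P := abelem_abelian abelP.

(** The p'-elements of [C] are central in [G], so [C / 'Z(C)] is a p-group and [C] is nilpotent; its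
    p-core is [P] and its p'-core is ['Z(G)]. *)
Lemma cent_pcore_dprod : P \x 'Z(G) = 'C_G(P).
Proof.
pose C := 'C_G(P)%G.
have nsCG : C <| G by rewrite norm_normalI ?norms_cent ?normal_norm.
have sPC : P \subset C by rewrite subsetI sPG.
have sZC : 'Z(G) \subset C.
  by rewrite subsetI center_sub centsC (subset_trans sPG) // centsC subsetIr.
have sZZC : 'Z(G) \subset 'Z(C).
  by rewrite subsetI sZC centsC (subset_trans (normal_sub nsCG)) // centsC subsetIr.
have p'Z x : x \in C -> p^'.-elt x -> x \in 'Z(G).
  exact: (p'elt_cent_normal_pgroup pr_p chi_ff chi1_gt1 norm_chi pP nsPG ntP).
have pCZ : p.-group (C / 'Z(C)).
  apply/pgroupP => r pr_r /Cauchy[]// xb /morphimP[x Nx Cx ->] oxb.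
  rewrite -pnatE // -oxb -[x](consttC p) morphM ?groupX //=.
  rewrite (@coset_id _ _ x.`_p^') ?mulg1.
    by apply: morph_p_elt; rewrite ?groupX ?p_elt_constt.
  by apply: (subsetP sZZC); rewrite p'Z ?groupX ?p_elt_constt.
have nilC : nilpotent C by rewrite -quotient_center_nil (pgroup_nil pCZ).
rewrite -[RHS](nilpotent_pcoreC p nilC); congr (_ \x _).
  apply/eqP; rewrite eqEsubset !pcore_max ?pcore_pgroup //.
    by apply: gFnormal_trans.
  exact: normalS sPC (normal_sub nsCG) nsPG.
apply/eqP; rewrite eqEsubset pcore_max /=; last 2 first.
- exact: p'group_center norm_chi.
- exact: normalS sZC (normal_sub nsCG) (center_normal G).
apply/subsetP => x Ox; rewrite p'Z ?(subsetP (pcore_sub p^' C)) //.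
exact: mem_p_elt (pcore_pgroup _ _) Ox.
Qed.

Section NotSylow.

Variable S : {group gT}.
Hypotheses (sylS : p.-Sylow(G) S) (neqPS : P :!=: S).

Let sSG : S \subset G := pHall_sub sylS.
Let pS : p.-group S := pHall_pgroup sylS.
Let sPS : P \subset S.
Proof. exact: pcore_sub_Hall. Qed.

Lemma pcore_not_Sylow_index : p = 2%N /\ #|S : P| = 2%N.
Proof.
have chi1 := Res_normal_pgroup1 pr_p chi1_gt1 norm_chi pP nsPG ntP.
have := cfnorm_Res_pgroup norm_chi pS sSG.
have /natrP[m ->] : '['Res[S] chi] \is a Num.nat.
  by rewrite Cnat_cfdot_char ?cfRes_char ?irr_char.
have Dchi1 : chi 1%g = #|P|.-1%:R by rewrite chi1 -subn1 natrB ?cardG_gt0.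
have q_gt2 : (2 < #|P|)%N by have := chi1_gt1; rewrite Dchi1 ltr1n ltn_predRL.
rewrite Dchi1 -natrX -natrM -natrD => /eqP; rewrite eqC_nat => /eqP.
rewrite -(Lagrange sPS).
have : (1 < #|S : P|)%N.
  by rewrite indexg_gt1; apply: contra neqPS => sSP; rewrite eqEsubset sPS.
have [_ p_q [a Dq]] := pgroup_pdiv pP ntP.
have /p_natP[b ->] : p.-nat #|S : P| by apply: pnat_dvd (dvdn_indexg _ _) pS.
case: b => [|b] // _.
rewrite Dq in p_q q_gt2 *.
(* Writing [q = c + 3] turns [q - 2] into [c.+1]; dividing the norm identity by [q] shows that
   [|S : P|] divides it. *)
have [c Dq2] : exists c, (p ^ a.+1 = c.+3)%N.
  by exists (p ^ a.+1 - 3)%N; rewrite -addn3 subnK.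
move=> E; have {E} : (p ^ b.+1 %| c.+1)%N.
  have [z Dz] : exists z, (p ^ b.+1 = z.+1)%N.
    by exists (p ^ b.+1).-1; rewrite prednK // expn_gt0 prime_gt0.
  rewrite Dz Dq2 in E *.
  have {}E : ((c.+1 + z.+1) * c.+3 = z.+1 * m * c.+3)%N.
    by move: E; rewrite /=; clear; rewrite -!mulnn; nia.
  move/eqP: E; rewrite eqn_pmul2r // => /eqP E.
  have : (z.+1 %| c.+1 + z.+1)%N by rewrite E dvdn_mulr.
  by rewrite dvdn_addl.
move=> dv; have p_c : (p %| c.+1)%N by apply: dvdn_trans dv; rewrite expnS dvdn_mulr.
have : (p %| c.+1 + 2)%N by rewrite addn2 -Dq2 expnS dvdn_mulr.
rewrite dvdn_addr // dvdn_prime2 // => /eqP p2; split => //.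
(* If [|S : P|] were at least 4, then 4 would divide [q - 2], but 4 divides [q] because [q] is a
   power of 2 above 2. *)
case: b dv => [|b]; first by rewrite p2.
rewrite p2 !expnS mulnA => /(dvdn_trans (dvdn_mulr _ (dvdnn _))) d4.
case: a Dq Dq2 {p_q q_gt2} => [|a] _; rewrite p2 // !expnS mulnA => Dq2.
have : (2 * 2 %| c.+1 + 2)%N by rewrite addn2 -Dq2 dvdn_mulr.
by rewrite dvdn_addr.
Qed.

Lemma pcore_not_Sylow_card : #|P| = 4%N.
Proof.
have [p2 iP] := pcore_not_Sylow_index.
have chi1 := Res_normal_pgroup1 pr_p chi1_gt1 norm_chi pP nsPG ntP.
have Dchi1 : chi 1%g = #|P|.-1%:R by rewrite chi1 -subn1 natrB ?cardG_gt0.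
have q_gt2 : (2 < #|P|)%N by have := chi1_gt1; rewrite Dchi1 ltr1n ltn_predRL.
have abelP2 : 2.-abelem P by rewrite -{1}p2.
have := index2_abelem_der1 abelP2 sPS iP.
have NchiS : 'Res[S] chi \is a character by rewrite cfRes_char ?irr_char.
have := cfnorm_ge_index2_abelian abP sPS iP NchiS.
set D := S^`(1)%G.
have sDP : D \subset P.
  rewrite der1_min ?(subset_trans sSG) ?normal_norm //.
  rewrite cyclic_abelian // prime_cyclic // card_quotient ?iP //.
  by rewrite (subset_trans sSG) ?normal_norm.
have normS : '['Res[S] chi] *+ 2 = #|P|%:R.
  have := cfnorm_Res_pgroup norm_chi pS sSG.
  rewrite -(Lagrange sPS) iP Dchi1 natrM -mulrA [2 * _]mulr_natl => E.
  apply: (mulfI (neq0CG P)); rewrite E.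
  case: #|P| q_gt2 => // q _ /=; rewrite -natrX -natrM -natrD; congr _%:R.
  by clear; nia.
have sDS : D \subset S := der_sub 1 S.
have sDG : D \subset G := subset_trans sDS sSG.
(* On S' the restriction of [chi] is that of [cfReg P - 1], and [cfReg P] is supported at 1 with
   value [|P|]. *)
have dotD : #|D|%:R * '['Res[D] ('Res[S] chi), 1] = #|P|%:R - #|D|%:R.
  rewrite cfResRes // -(cfResRes chi sDP sPG).
  rewrite (Res_normal_pgroupE pr_p chi_ff chi1_gt1 norm_chi pP nsPG ntP).
  rewrite linearB /= cfRes_cfun1 // cfdotBl cfnorm1 mulrBr mulr1; congr (_ - _).
  rewrite cfdotE mulVKf ?neq0CG // (bigD1 1%g) //= cfun11 conjC1 mulr1.
  rewrite cfRes1 cfRegE eqxx big1 ?addr0 // => x /andP[Dx ntx].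
  by rewrite cfResE // cfRegE (negPf ntx) mul0r.
rewrite normS cfRes1 -(ler_pM2l (gt0CG D)) mulrDr dotD Dchi1.
rewrite addrA lerBlDr -!natrM -!natrD ler_nat => le1 le2.
have {}le1 : (#|P| <= 2 * #|D|)%N.
  by case: #|P| q_gt2 le1 => //= q _; clear; nia.
(* With [d = |D|], squaring [q <= 2 d] and using [d^2 <= q] gives [q^2 <= 4 q]. *)
have le4 : (#|P| <= 4)%N.
  have {}le2 : (#|D| * #|D| <= #|P|)%N by rewrite mulnn.
  move: q_gt2 (leq_mul le1 le1) le2; clear.
  by move: #|P| #|D| => q d q_gt2 le1 le2; rewrite leqNgt; apply/negP => q_gt4; nia.
have [_ _ [a Dq]] := pgroup_pdiv pP ntP; move: q_gt2 le4; rewrite Dq p2.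
case: a {Dq} => [|[|a]] // _; rewrite !expnS; have := expn_gt0 2 a; clear; nia.
Qed.

End NotSylow.
End Exceptional.

Theorem theorem2p5 (gT : finGroupType) (p : nat) (G : {group gT}) (chi : 'CF(G)) :
  prime p ->
  chi \in irr G ->
  cfaithful chi ->
  1 < chi 1%g ->
  (forall x, x \in G -> p_singular p x -> is_root_of_unity (chi x)) ->
  'O_p(G) != 1%g ->
  ('O_p(G)%G \in 'Syl_p(G)
   /\ p.-abelem 'O_p(G)
   /\ 'O_p(G) \x 'Z(G) = 'C_G('O_p(G))
   /\ (forall i j : Iirr 'O_p(G), 'chi_i != 1 -> 'chi_j != 1 ->
         exists2 g, g \in G & ('chi_i ^ g)%CF = 'chi_j)
   /\ chi 1%g = (#|'O_p(G)|)%:R - 1)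
  \/
  (p = 2%N
   /\ (G \isog setX [set: {perm 'I_4}] 'Z(G))
   /\ odd #|'Z(G)|).
Proof.
move=> pr_p /irrP[i ->] chi_ff chi1_gt1 root_chi ntP.
have norm_chi x : x \in G -> p_singular p x -> `|'chi_i x| = 1.
  by move=> Gx px; apply/norm_root_of_unity/root_chi.
have pP := pcore_pgroup p G; have nsPG := pcore_normal p G.
have abelP := normal_pgroup_abelem pr_p chi1_gt1 norm_chi pP nsPG ntP.
have chi1 := Res_normal_pgroup1 pr_p chi1_gt1 norm_chi pP nsPG ntP.
have defC := cent_pcore_dprod pr_p chi_ff chi1_gt1 norm_chi ntP.
have [S sylS] := Sylow_exists p G.
(* Alternative (1) is the case where [P] is the Sylow subgroup [S]; otherwise [p = 2], [|S : P| = 2]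
   and [|P| = 4], which leads to (2). *)
have [eqPS | neqPS] := eqVneq 'O_p(G)%g (S : {set gT}).
  left; do 4?split=> //; first by rewrite inE /= eqPS.
  exact: irr_normal_pgroup_transitive pr_p chi1_gt1 norm_chi _ pP nsPG ntP.
right.
have [p2 iSP] :=
  pcore_not_Sylow_index pr_p chi1_gt1 norm_chi ntP sylS neqPS.
have oP := pcore_not_Sylow_card pr_p chi_ff chi1_gt1 norm_chi ntP sylS neqPS.
have oddZ : odd #|'Z(G)|.
  by rewrite odd_2'nat -p2; apply: (p'group_center chi_ff chi1_gt1 norm_chi).
split=> //; split=> //; rewrite p2 in oP defC sylS iSP.
exact: card4_pcore_isog_S4_center (erefl _) oP defC oddZ sylS iSP.
Qed.
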